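(* There is a sequence $(\phi_h)_{h\geq 1}$ of first-order sentences over the signature $\{E\}$ ($E$ binary) of size $O(h)$ such that for each $h\geq 1$, every sentence in Barthelmann-Schwentick normal form that is equivalent to $\phi_h$ on $\mathfrak{F}_{\leqslant h}$ has size $>\mathrm{Tower}(h)$.
   Context: $\mathrm{Tower}(0,x):=x$, $\mathrm{Tower}(k+1,x):=2^{\mathrm{Tower}(k,x)}$, $\mathrm{Tower}(h):=\mathrm{Tower}(h,1)$. A forest is a finite directed graph (a $\{E\}$-structure) in which every vertex has indegree at most $1$ and whose underlying undirected graph is acyclic; roots are vertices of indegree $0$; its height is the length of the longest directed path starting at a root. $\mathfrak{F}_{\leqslant h}$ is the class of all finite forests of height $\leq h$. The size of a formula is its length as a word. A formula $\phi(\overline{y},z)$ is $r$-local around $z$ if for every structure $\mathcal{A}$ and all tuples, $\mathcal{A}\models\phi[\overline{a},c]$ iff $\mathcal{A}[\{\text{entries of }\overline{a}\}\cup N_r^{\mathcal{A}}(c)]\models\phi[\overline{a},c]$, where $N_r^{\mathcal{A}}(c)$ is the set of elements at distance $\leq r$ from $c$ in the Gaifman graph. A sentence is in Barthelmann-Schwentick normal form if it has the form $\exists y_1\cdots\exists y_n\forall z\,\phi(y_1,\dots,y_n,z)$ with $n\ge0$ and $\phi$ $r$-local around $z$ for some $r\geq0$. *)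

(* Defs.v *)
From mathcomp Require Import all_boot.

Set Implicit Arguments.
Unset Strict Implicit.
Unset Printing Implicit Defensive.

Fixpoint Tower2 (k x : nat) : nat :=
  if k is k'.+1 then 2 ^ Tower2 k' x else x.

Definition Tower (h : nat) : nat := Tower2 h 1.

Inductive formula : Type :=
| Edge of nat & nat
| Equal of nat & nat
| Not of formula
| And of formula & formula
| Or of formula & formula
| Imp of formula & formula
| Iff of formula & formula
| Exists of nat & formula
| Forall of nat & formula.

(* The alphabet is infinite: every variable is a single symbol. *)
Inductive symbol : Type :=
| SVar of nat
| SE | SEqual | SNot | SAnd | SOr | SImp | SIff | SExists | SForall
| SLpar | SRpar | SComma.

Fixpoint word (f : formula) : seq symbol :=
  match f with
  | Edge x y => [:: SE; SLpar; SVar x; SComma; SVar y; SRpar]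
  | Equal x y => [:: SVar x; SEqual; SVar y]
  | Not f => SNot :: word f
  | And f g => SLpar :: word f ++ SAnd :: word g ++ [:: SRpar]
  | Or f g => SLpar :: word f ++ SOr :: word g ++ [:: SRpar]
  | Imp f g => SLpar :: word f ++ SImp :: word g ++ [:: SRpar]
  | Iff f g => SLpar :: word f ++ SIff :: word g ++ [:: SRpar]
  | Exists x f => SExists :: SVar x :: word f
  | Forall x f => SForall :: SVar x :: word f
  end.

Definition fsize (f : formula) : nat := size (word f).

Fixpoint free_vars (f : formula) : seq nat :=
  match f with
  | Edge x y | Equal x y => [:: x; y]
  | Not f => free_vars f
  | And f g | Or f g | Imp f g | Iff f g => free_vars f ++ free_vars g
  | Exists x f | Forall x f => [seq y <- free_vars f | y != x]
  end.

Definition sentence (f : formula) : Prop := free_vars f = [::].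

(* {E}-structures, finite or infinite. Nonemptiness of the universe is not a
   field: it is implied by the presence of an assignment wherever one is
   quantified over, and is required explicitly of forests. *)
Record structure : Type := Structure {
  carrier :> Type;
  edge : carrier -> carrier -> Prop
}.

Definition update (A : Type) (v : nat -> A) (x : nat) (a : A) : nat -> A :=
  fun y => if y == x then a else v y.

Fixpoint sat (A : structure) (v : nat -> A) (f : formula) : Prop :=
  match f with
  | Edge x y => edge (v x) (v y)
  | Equal x y => v x = v y
  | Not f => ~ sat v f
  | And f g => sat v f /\ sat v g
  | Or f g => sat v f \/ sat v g
  | Imp f g => sat v f -> sat v g
  | Iff f g => sat v f <-> sat v g
  | Exists x f => exists a : A, sat (update v x a) f
  | Forall x f => forall a : A, sat (update v x a) f
  end.

(* Only meant for sentences on nonempty structures, where the truth value does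
   not depend on the assignment. *)
Definition models (A : structure) (f : formula) : Prop :=
  forall v : nat -> A, sat v f.

Definition gaifman (A : structure) (a b : A) : Prop :=
  a <> b /\ (edge a b \/ edge b a).

Fixpoint nbhd (A : structure) (r : nat) (c x : A) : Prop :=
  match r with
  | 0 => x = c
  | r'.+1 => nbhd r' c x \/ exists y : A, nbhd r' c y /\ gaifman y x
  end.

Definition induced (A : structure) (S : A -> Prop) : structure :=
  @Structure {x : A | S x} (fun a b => edge (sval a) (sval b)).

(* phi(ys, z) is r-local around z. As the variables z :: ys are pairwise
   distinct in the use below, (a, c) ranges over all tuples when the assignment
   v does, with a = v ys and c = v z; w is the same tuple read in the induced
   substructure. Values on variables outside z :: ys play no role, since they
   are not free in phi. *)
Definition local_around (r : nat) (ys : seq nat) (z : nat) (phi : formula) :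
    Prop :=
  forall (A : structure) (v : nat -> A),
  let S x := (exists2 y, y \in ys & x = v y) \/ nbhd r (v z) x in
  forall w : nat -> induced S,
    (forall y, y \in z :: ys -> sval (w y) = v y) ->
    sat v phi <-> sat w phi.

Definition BSNF (psi : formula) : Prop :=
  exists (ys : seq nat) (z : nat) (phi : formula) (r : nat),
    [/\ uniq (z :: ys),
        {subset free_vars phi <= z :: ys},
        local_around r ys z phi
      & psi = foldr Exists (Forall z phi) ys].

Section Forests.
Variables (T : finType) (e : rel T).

Definition graph : structure := @Structure T (fun x y => e x y).

Definition indegree (x : T) : nat := #|[set y | e y x]|.

Definition root (x : T) : bool := indegree x == 0.

Definition undirected : rel T := fun x y => e x y || e y x.

(* Loops and pairs of antiparallel edges count as cycles (of length 1 and 2);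
   the bound 2 in the second clause is there because a single edge x -> y
   already makes [:: x; y] a closed walk of the symmetric closure. *)
Definition undirected_acyclic : Prop :=
  (forall x y, e x y -> ~~ e y x) /\
  (forall c : seq T, ucycle undirected c -> size c <= 2).

Definition is_forest : Prop :=
  [/\ 0 < #|T|, forall x, indegree x <= 1 & undirected_acyclic].

(* Length of a path = its number of edges; a path repeats no vertex, whence
   the bound n < #|T|. *)
Definition height : nat :=
  \max_(x | root x)
    \max_(n < #|T| | [exists p : n.-tuple T, path e x p && uniq (x :: p)]) n.

End Forests.

Definition equiv_on_forests (h : nat) (f g : formula) : Prop :=
  forall (T : finType) (e : rel T), is_forest e -> height e <= h ->
    models (graph e) f <-> models (graph e) g.

(* Main.v *)
From Stdlib Require Import PeanoNat ProofIrrelevance.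
Require Import Defs.
From mathcomp Require Import all_boot zify.

Set Implicit Arguments.
Unset Strict Implicit.
Unset Printing Implicit Defensive.

(** A number [n < Tower h] is coded by the tree of height at most [h] whose
root has one subtree, coding [j], for each bit [j] of [n]; two such trees code
the same number iff their roots are [h]-step bisimilar, which is expressible by
a formula of size [O(h)]. The sentence [twin_formula h] says that every root has
a twin, that is, another root coding the same number. It holds in the forest
with two copies of every tree, and fails once one of these trees is deleted. A
normal form with fewer than [2 * Tower h] existential variables cannot tell the
two forests apart: some tree contains no witness, and the local formula does not
notice its deletion. *)

Definition in_image (A B : Type) (F : A -> B) (b : B) : Prop :=
  exists a, F a = b.

Section Embeddings.
Variables (A B : structure) (F : A -> B).

Definition embedding : Prop :=
  injective F /\ forall x y, edge (F x) (F y) <-> edge x y.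

Definition isomorphism : Prop := embedding /\ forall b, in_image F b.

Definition component_embedding : Prop :=
  embedding /\ forall a b, edge (F a) b \/ edge b (F a) -> in_image F b.

End Embeddings.

Lemma update_map (A B : Type) (F : A -> B) (s : seq nat) x v w :
    {in [seq y <- s | y != x], F \o v =1 w} ->
  forall a, {in s, F \o update v x a =1 update w x (F a)}.
Proof.
move=> vw a y ys; rewrite /= /update; case: eqVneq => // yx.
by apply: vw; rewrite mem_filter yx.
Qed.

Lemma sat_isomorphism (A B : structure) (F : A -> B) (f : formula) v w :
  isomorphism F -> {in free_vars f, F \o v =1 w} -> sat v f <-> sat w f.
Proof.
move=> [[injF edgeF] surjF].
elim: f v w => [x y|x y|f IH|f IHf g IHg|f IHf g IHg|f IHf g IHg|f IHf g IHg
  |x f IH|x f IH] v w vw /=; try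
  (have /IHf sat_f : {in free_vars f, F \o v =1 w}
     by move=> y yf; apply: vw; rewrite mem_cat yf);
  try (have /IHg sat_g : {in free_vars g, F \o v =1 w}
     by move=> y yg; apply: vw; rewrite mem_cat yg orbT); try tauto.
- by rewrite -!vw ?inE ?eqxx ?orbT //=; have := edgeF (v x) (v y); tauto.
- by rewrite -!vw ?inE ?eqxx ?orbT //=; split=> [->|/injF].
- by have := IH _ _ vw; tauto.
- split=> [[a /(IH _ _ (update_map vw _))]|[b]]; first by exists (F a).
  by have [a <-] := surjF b => /(IH _ _ (update_map vw _)); exists a.
- split=> [sat_all b|sat_all a]; last exact/(IH _ _ (update_map vw _)).
  by have [a <-] := surjF b; apply/(IH _ _ (update_map vw _)).
Qed.

Lemma sat_coincidence (A : structure) (f : formula) (v w : nat -> A) :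
  {in free_vars f, v =1 w} -> sat v f <-> sat w f.
Proof.
apply: (sat_isomorphism (F := id)); split=> [|b]; last by exists b.
by split.
Qed.

Lemma sat_foldr_Exists (A : structure) (ys : seq nat) (f : formula)
    (v : nat -> A) :
  sat v (foldr Exists f ys) <->
  exists2 w, (forall x, x \notin ys -> w x = v x) & sat w f.
Proof.
elim: ys v => [|y ys IH] v /=.
  split=> [|[w wv]]; first by exists v.
  by apply: (proj1 (sat_coincidence _)) => x _; apply: wv.
split=> [[a /IH[w wv wf]]|[w wv wf]].
  exists w => // x; rewrite inE negb_or => /andP[xy xys].
  by rewrite wv // /update (negbTE xy).
exists (w y); apply/IH; exists w => // x xys; rewrite /update.
by case: eqVneq => [->//|xy]; apply: wv; rewrite inE negb_or xy.
Qed.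

Lemma lift_assignment (A B : Type) (F : A -> B) (ys : seq nat)
    (u : nat -> A) (w : nat -> B) :
  {in ys, forall y, in_image F (w y)} ->
  exists2 v, (forall x, x \notin ys -> v x = u x) & {in ys, F \o v =1 w}.
Proof.
elim: ys => [|y ys IH] im; first by exists u.
have [x xys|v vu vw] := IH; first by apply: im; rewrite inE xys orbT.
have [a Fa] := im y (mem_head _ _).
exists (update v y a) => x; rewrite inE /= /update; case: eqVneq => [->|_] //=.
  exact: vu.
exact: vw.
Qed.

Lemma fsize_gt0 f : 0 < fsize f.
Proof. by case: f. Qed.

Lemma fsize_foldr_Exists (f : formula) ys :
  fsize (foldr Exists f ys) = 2 * size ys + fsize f.
Proof. by rewrite /fsize; elim: ys => //= y ys ->; lia. Qed.

Section InducedMap.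
Variables (A B : structure) (F : A -> B) (S : A -> Prop) (S' : B -> Prop).
Hypothesis S'F : forall x, S' (F x) <-> S x.

Definition induced_map (x : induced S) : induced S' :=
  exist S' (F (sval x)) (proj2 (S'F (sval x)) (svalP x)).

Lemma induced_map_isomorphism :
  embedding F -> (forall b, S' b -> in_image F b) -> isomorphism induced_map.
Proof.
move=> [injF edgeF] S'_image; split=> [|[b S'b]].
  split=> [[x Sx] [y Sy] /(congr1 sval) /injF /= xy|x y]; last exact: edgeF.
  exact: subset_eq_compat.
have [a Fa] := S'_image b S'b; subst b.
by exists (exist S a (proj1 (S'F a) S'b)); apply: subset_eq_compat.
Qed.

End InducedMap.

Definition local_domain (A : structure) r (ys : seq nat) z (v : nat -> A) :
    A -> Prop :=
  fun x => (exists2 y, y \in ys & x = v y) \/ nbhd r (v z) x.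

Lemma nbhd_center (A : structure) r (c : A) : nbhd r c c.
Proof. by elim: r => //= r IH; left. Qed.

Lemma local_domain_assignment (A : structure) r ys z (v : nat -> A) :
  exists v' : nat -> induced (local_domain r ys z v),
    {in z :: ys, forall y, sval (v' y) = v y}.
Proof.
have in_domain y : local_domain r ys z v (if y \in z :: ys then v y else v z).
  rewrite inE; case: eqP => [->|_] /=; first by right; apply: nbhd_center.
  by case: ifP => yys; [left; exists y | right; apply: nbhd_center].
by exists (fun y => exist _ _ (in_domain y)) => y /= ->.
Qed.

Section ComponentEmbedding.
Variables (A B : structure) (F : A -> B).
Hypothesis compF : component_embedding F.

Let injF : injective F := proj1 (proj1 compF).
Let edgeF x y : edge (F x) (F y) <-> edge x y := proj2 (proj1 compF) x y.
Let adjacentF a b : edge (F a) b \/ edge b (F a) -> in_image F b :=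
  proj2 compF a b.

Lemma nbhd_in_image r c b : nbhd r (F c) b -> in_image F b.
Proof.
elim: r b => [|r IH] b /=; first by move->; exists c.
move=> [/IH //|[y [/IH [a <-]] [_ eab]]].
exact: adjacentF eab.
Qed.

Lemma gaifman_component_embedding x y : gaifman (F x) (F y) <-> gaifman x y.
Proof.
rewrite /gaifman !edgeF; split=> -[xy exy]; split=> // FxFy; apply: xy.
  by rewrite FxFy.
exact: injF.
Qed.

Lemma nbhd_component_embedding r c x : nbhd r (F c) (F x) <-> nbhd r c x.
Proof.
elim: r x => [|r IH] x /=; first by split=> [/injF|->].
split=> -[/IH|[y [cy yx]]]; try by left.
- have [y' yE] := nbhd_in_image cy; subst y.
  by right; exists y'; split; [apply/IH | apply/gaifman_component_embedding].
- by right; exists (F y); split; [apply/IH | apply/gaifman_component_embedding].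
Qed.

Section Assignments.
Variables (r : nat) (ys : seq nat) (z : nat) (v : nat -> A) (w : nat -> B).
Hypothesis vw : {in z :: ys, F \o v =1 w}.

Lemma local_domain_component_embedding x :
  local_domain r ys z w (F x) <-> local_domain r ys z v x.
Proof.
have vw_ys y : y \in ys -> F (v y) = w y.
  by move=> yys; apply: vw; rewrite inE yys orbT.
rewrite /local_domain -(vw (mem_head _ _)) nbhd_component_embedding.
split=> -[[y yys]|]; try by right.
  by rewrite -vw_ys // => /injF xy; left; exists y.
by move=> ->; left; exists y => //; rewrite vw_ys.
Qed.

Lemma local_domain_in_image b : local_domain r ys z w b -> in_image F b.
Proof.
move=> [[y yys ->]|]; last by rewrite -(vw (mem_head _ _)) => /nbhd_in_image.
by exists (v y); apply: vw; rewrite inE yys orbT.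
Qed.

Lemma sat_component_embedding phi :
  local_around r ys z phi -> sat v phi <-> sat w phi.
Proof.
move=> loc; have [v' v'E] := local_domain_assignment r ys z v.
pose G := induced_map local_domain_component_embedding.
have isoG : isomorphism G.
  exact: induced_map_isomorphism (proj1 compF) local_domain_in_image.
have locA : sat v phi <-> sat v' phi := loc A v v' v'E.
have locB : sat w phi <-> sat (G \o v') phi.
  by apply: (loc B w (G \o v')) => y yz; rewrite /= v'E //; apply: vw.
have middle : sat v' phi <-> sat (G \o v') phi by apply: sat_isomorphism isoG _.
tauto.
Qed.

End Assignments.

End ComponentEmbedding.

(* The witnesses are the values of the existential variables, each of which
takes two symbols of [psi]. *)
Lemma BSNF_witnesses (B : structure) psi :
    BSNF psi -> inhabited B -> models B psi ->
  exists (n : nat) (w : 'I_n -> B), 2 * n < fsize psi /\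
    forall (A : structure) (F : A -> B), component_embedding F ->
      (forall i, in_image F (w i)) -> models A psi.
Proof.
move=> [ys [z [phi [r [_ _ loc ->]]]]] [b0] /(_ (fun=> b0)).
move=> /sat_foldr_Exists[w _ satw].
exists (size ys), (fun i => w (nth 0 ys i)); split.
  by rewrite fsize_foldr_Exists /fsize /=; lia.
move=> A F compF imw u.
have w_image : {in ys, forall y, in_image F (w y)}.
  move=> y yys; have := imw (Ordinal (etrans (index_mem y ys) yys)).
  by rewrite /= nth_index.
have [v vu vw] := lift_assignment u w_image.
apply/sat_foldr_Exists; exists v => // a.
apply/(sat_component_embedding (F := F) (w := update w z (F a)) _ _ loc) => //.
by apply: update_map => y; rewrite mem_filter inE => /andP[/negPf-> /vw].
Qed.

Section GradedForest.
Variables (T : finType) (e : rel T) (depth : T -> nat).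
Hypothesis depth_edge : forall x y, e x y -> depth y = (depth x).+1.

Lemma graded_height h : (forall x, depth x <= h) -> height e <= h.
Proof.
move=> depth_le; apply/bigmax_leqP => x _; apply/bigmax_leqP => n /existsP[p].
case/andP=> ep _; rewrite -(size_tuple p).
suff depth_last : depth (last x p) = depth x + size p.
  by have := depth_le (last x p); lia.
by elim: (tval p) x ep => [|y s IH] x /= => [_|/andP[/depth_edge dy /IH]]; lia.
Qed.

Hypothesis parent_unique : forall x y z, e x z -> e y z -> x = y.

(* Both neighbours on a cycle of a vertex of maximal depth are its parent. *)
Lemma graded_acyclic : undirected_acyclic e.
Proof.
split=> [x y exy|c /andP[cycle_c uniq_c]].
  by apply/negP => /depth_edge; rewrite (depth_edge exy); lia.
rewrite leqNgt; apply/negP => long_c.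
have [x xc xmax] : exists2 x, x \in c & {in c, forall y, depth y <= depth x}.
  case: c long_c {cycle_c uniq_c} => // x0 c _.
  by case: (arg_maxnP depth (mem_head x0 c)) => x xc xmax; exists x.
have [i s rot_c] := rot_to xc.
have up y : y \in x :: s -> undirected e x y -> e y x.
  by rewrite -rot_c mem_rot => /xmax dy /orP[/depth_edge|//]; lia.
move: long_c cycle_c uniq_c.
rewrite -(size_rot i) -(rot_cycle i) -(rot_uniq i) rot_c.
case: s up {rot_c} => // y s; case/lastP: s => // s z up _ /=.
rewrite !rcons_path last_rcons => /and3P[exy _ ezx] /and3P[_ ys _].
have eyx : e y x by apply: up => //; rewrite !inE eqxx orbT.
have {}ezx : e z x.
  by apply: up; rewrite 1?/undirected 1?orbC // !inE mem_rcons mem_head !orbT.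
by move: ys; rewrite (parent_unique eyx ezx) mem_rcons mem_head.
Qed.

Lemma graded_forest : 0 < #|T| -> is_forest e.
Proof.
split=> //; last exact: graded_acyclic.
move=> x; apply/card_le1_eqP => y z; rewrite !inE => yx zx.
exact: parent_unique zx yx.
Qed.

End GradedForest.

Fixpoint bisimilar (A : structure) (k : nat) (a b : A) : Prop :=
  if k is k'.+1 then
    (forall u, edge a u -> exists2 w, edge b w & bisimilar k' u w) /\
    (forall u, edge b u -> exists2 w, edge a w & bisimilar k' u w)
  else True.

Lemma bisimilar_refl (A : structure) k (a : A) : bisimilar k a a.
Proof. by elim: k a => //= k IH a; split=> u au; exists u. Qed.

Lemma bisimilarS (A : structure) k (a b : A) :
  bisimilar k.+1 a b <->
  forall u, edge a u \/ edge b u -> exists w,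
    (edge a u /\ edge b w \/ edge b u /\ edge a w) /\ bisimilar k u w.
Proof.
split=> [[forth back] u [au|bu]|match_child].
- by have [w bw uw] := forth u au; exists w; tauto.
- by have [w aw uw] := back u bu; exists w; tauto.
split=> u eu.
- have [|w [[[_ bw]|[bu _]] uw]] := match_child u.
  + by left.
  + by exists w.
  + by exists u => //; apply: bisimilar_refl.
- have [|w [[[au _]|[_ aw]] uw]] := match_child u.
  + by right.
  + by exists u => //; apply: bisimilar_refl.
  + by exists w.
Qed.

(* Following [bisimilarS] rather than the definition of [bisimilar] leaves a
single recursive call, whence the linear size; four variables suffice because
[x] and [y] may be requantified below. *)
Fixpoint bisimilar_formula (k x y u w : nat) : formula :=
  if k is k'.+1 then
    Forall u (Imp (Or (Edge x u) (Edge y u))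
      (Exists w (And
        (Or (And (Edge x u) (Edge y w)) (And (Edge y u) (Edge x w)))
        (bisimilar_formula k' u w x y))))
  else Equal x x.

Lemma sat_bisimilar_formula (A : structure) k x y u w (v : nat -> A) :
  uniq [:: x; y; u; w] ->
  sat v (bisimilar_formula k x y u w) <-> bisimilar k (v x) (v y).
Proof.
elim: k x y u w v => [|k IH] x y u w v uniq_xyuw //.
have uniq_uwxy : uniq [:: u; w; x; y].
  by rewrite (@perm_uniq _ _ [:: x; y; u; w]) // (perm_catC [:: u; w]).
apply: iff_trans (iff_sym (bisimilarS _ _ _)).
have IHv a b := IH u w x y (update (update v u a) w b) uniq_uwxy.
move: uniq_xyuw IHv; rewrite /= !inE !negb_or andbT.
case/and3P=> /and3P[_ /negPf xu /negPf xw] /andP[/negPf yu /negPf yw] /negPf uw.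
rewrite /update !eqxx xu xw yu yw uw => IHv.
by split=> match_child a /match_child[b [ab /IHv sab]]; exists b; split.
Qed.

Lemma fsize_bisimilar_formula k x y u w :
  fsize (bisimilar_formula k x y u w) = 58 * k + 3.
Proof.
rewrite /fsize; elim: k x y u w => [|k IH] x y u w //=.
by rewrite !size_cat /= IH; lia.
Qed.

Definition parentless (A : structure) (a : A) : Prop := forall b, ~ edge b a.

Definition parentless_formula (x y : nat) : formula :=
  Forall y (Not (Edge y x)).

Definition twin_formula (h : nat) : formula :=
  Forall 0 (Imp (parentless_formula 0 1)
    (Exists 1 (And (And (Not (Equal 0 1)) (parentless_formula 1 2))
                   (bisimilar_formula h 0 1 2 3)))).

Lemma models_twin_formula (A : structure) h :
  models A (twin_formula h) <->
  forall a : A, parentless a ->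
    exists b, [/\ a <> b, parentless b & bisimilar h a b].
Proof.
have bisim (v : nat -> A) a b :
    sat (update (update v 0 a) 1 b) (bisimilar_formula h 0 1 2 3) <->
    bisimilar h a b by apply: sat_bisimilar_formula.
split=> [twins a pa|twins v a pa].
  by have [b [[ab pb] /bisim sab]] := twins (fun=> a) a pa; exists b.
by have [b [ab pb sab]] := twins a pa; exists b; split; [|apply/bisim].
Qed.

Lemma fsize_twin_formula h : fsize (twin_formula h) = 58 * h + 38.
Proof.
by rewrite /fsize /= !size_cat /= -/(fsize _) fsize_bisimilar_formula; lia.
Qed.

Lemma subset_free_vars_Forall x f s :
  {subset free_vars f <= x :: s} -> {subset free_vars (Forall x f) <= s}.
Proof.
by move=> fs y; rewrite mem_filter => /andP[/negPf yx /fs]; rewrite inE yx.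
Qed.

Lemma subset_free_vars_Exists x f s :
  {subset free_vars f <= x :: s} -> {subset free_vars (Exists x f) <= s}.
Proof. exact: subset_free_vars_Forall. Qed.

Lemma subset_free_vars_And f g (s : seq nat) :
    {subset free_vars f <= s} -> {subset free_vars g <= s} ->
  {subset free_vars (And f g) <= s}.
Proof. by move=> fs gs x; rewrite mem_cat => /orP[/fs|/gs]. Qed.

Lemma subset_free_vars_Imp f g (s : seq nat) :
    {subset free_vars f <= s} -> {subset free_vars g <= s} ->
  {subset free_vars (Imp f g) <= s}.
Proof. exact: subset_free_vars_And. Qed.

Lemma subset_free_vars_bisimilar_formula k x y u w :
  {subset free_vars (bisimilar_formula k x y u w) <= [:: x; y]}.
Proof.
elim: k x y u w => [|k IH] x y u w; first by move=> t; rewrite !inE orbb => ->.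
apply/subset_free_vars_Forall/subset_free_vars_Imp.
  by move=> t; rewrite !inE; lia.
apply/subset_free_vars_Exists/subset_free_vars_And.
  by move=> t; rewrite !inE; lia.
by move=> t /IH; rewrite !inE; lia.
Qed.

Lemma sentence_twin_formula h : sentence (twin_formula h).
Proof.
suff: {subset free_vars (twin_formula h) <= [::]}.
  by rewrite /sentence; case: free_vars => // x s /(_ x (mem_head _ _)).
apply/subset_free_vars_Forall/subset_free_vars_Imp => //.
apply/subset_free_vars_Exists/subset_free_vars_And.
  by move=> t; rewrite !inE; lia.
by move=> t /subset_free_vars_bisimilar_formula; rewrite !inE; lia.
Qed.

Lemma testbit_lt_expn m n j : n < 2 ^ m -> Nat.testbit n j -> j < m.
Proof.
elim: m n j => [|m IH] n j.
  by rewrite expn0 ltnS leqn0 => /eqP->; rewrite Nat.bits_0.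
case: j => // j n_lt; apply: (IH (Nat.div2 n) j).
by have := Nat.div2_odd n; rewrite expnS in n_lt; lia.
Qed.

Lemma testbit_ltn n j : Nat.testbit n j -> j < n.
Proof. by apply: testbit_lt_expn; apply: ltn_expl. Qed.

Lemma testbit_lt_Tower k n j : n < Tower k.+1 -> Nat.testbit n j -> j < Tower k.
Proof. exact: testbit_lt_expn. Qed.

Lemma ltn_Tower0 n : n < Tower 0 -> n = 0.
Proof. by case: n. Qed.

Lemma Tower_gt0 k : 0 < Tower k.
Proof. by case: k => // k; rewrite /Tower /= expn_gt0. Qed.

Definition Ackermann_code (A : structure) (code : A -> nat) : Prop :=
  forall a j, Nat.testbit (code a) j <-> exists2 b, edge a b & code b = j.

Section AckermannCode.
Variables (A : structure) (code : A -> nat).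
Hypothesis codeP : Ackermann_code code.

Lemma edge_testbit a b : edge a b -> Nat.testbit (code a) (code b).
Proof. by move=> ab; apply/codeP; exists b. Qed.

Lemma eq_code_bisimilar k a b : code a = code b -> bisimilar k a b.
Proof.
elim: k a b => //= k IH a b ab; split=> u /edge_testbit.
  by rewrite ab => /codeP[w bw /esym/IH]; exists w.
by rewrite -ab => /codeP[w aw /esym/IH]; exists w.
Qed.

Lemma bisimilar_eq_code k a b :
  code a < Tower k -> code b < Tower k -> bisimilar k a b -> code a = code b.
Proof.
elim: k a b => [|k IH] a b ak bk.
  by rewrite (ltn_Tower0 ak) (ltn_Tower0 bk).
case=> forth back; apply: Nat.bits_inj => j.
have child c d : code c < Tower k.+1 -> edge c d -> code d < Tower k.
  by move=> ck /edge_testbit; apply: testbit_lt_Tower.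
apply/idP/idP => /codeP[u eu <-]; apply/codeP.
  have [w bw uw] := forth u eu; exists w => //.
  by rewrite (IH u w) ?(child a u) ?(child b w).
have [w aw uw] := back u eu; exists w => //.
by rewrite (IH u w) ?(child b u) ?(child a w).
Qed.

End AckermannCode.

Lemma exists_notin_codom (I J : finType) (f : J -> I) :
  #|J| < #|I| -> exists i, i \notin codom f.
Proof.
move=> JI; apply/existsP; apply: contraLR JI; rewrite negb_exists -leqNgt.
move=> /forallP onto; rewrite -(size_codom f); apply: leq_trans (card_size _).
by apply/subset_leq_card/subsetP => i _; have := onto i; rewrite negbK.
Qed.

Section CodeForest.
Variable h : nat.

Definition has_bit : rel 'I_(Tower h) := fun n j => Nat.testbit n j.

Lemma size_has_bit_path k (n : 'I_(Tower h)) p :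
  n < Tower k -> path has_bit n p -> size p <= k.
Proof.
elim: p n k => [|j p IH] n [|k] //= nk /andP[nj pj].
  by rewrite /has_bit (ltn_Tower0 nk) Nat.bits_0 in nj.
by apply: IH pj; apply: testbit_lt_Tower nj.
Qed.

Section Family.
Variables (I : finType) (number : I -> 'I_(Tower h)).

(* The tree [i] codes [number i]; its vertices are the descending paths of
numbers from [number i], each one a bit of the preceding one. *)
Definition vertex : finType :=
  {x : I * {bseq h of 'I_(Tower h)} | path has_bit (number x.1) x.2}.

Implicit Types x y z : vertex.

Definition tree x : I := (val x).1.
Definition trail x : seq 'I_(Tower h) := (val x).2.
Definition code x : 'I_(Tower h) := last (number (tree x)) (trail x).

Definition arc : rel vertex := fun x y =>
  (tree x == tree y) && [exists l, trail y == rcons (trail x) l].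

Definition code_forest : structure := graph arc.

Lemma arcP x y :
  reflect (tree x = tree y /\ exists l, trail y = rcons (trail x) l) (arc x y).
Proof. by apply: (iffP andP) => -[/eqP xy /'exists_eqP yl]. Qed.

Lemma vertex_eq x y : tree x = tree y -> trail x = trail y -> x = y.
Proof.
rewrite /tree /trail => Et Ep; apply/val_inj.
by rewrite [LHS]surjective_pairing Et (val_inj Ep) -surjective_pairing.
Qed.

Lemma trailP x : path has_bit (number (tree x)) (trail x).
Proof. exact: valP x. Qed.

Lemma vertex_exists i p : path has_bit (number i) p ->
  exists2 x, tree x = i & trail x = p.
Proof.
move=> ip; have sz := size_has_bit_path (ltn_ord (number i)) ip.
by exists (exist _ (i, Bseq sz) ip).
Qed.

Lemma arc_parent x y z : arc x z -> arc y z -> x = y.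
Proof.
move=> /arcP[xz [l zl]] /arcP[yz [m zm]]; apply: vertex_eq; first by rewrite xz.
by move: zl; rewrite zm => /rcons_inj[].
Qed.

Lemma arc_depth x y : arc x y -> size (trail y) = (size (trail x)).+1.
Proof. by move=> /arcP[_ [l ->]]; rewrite size_rcons. Qed.

Lemma code_forest_is_forest : 0 < #|I| -> is_forest arc.
Proof.
case/card_gt0P=> i _; apply: graded_forest arc_depth arc_parent _.
by have [x _ _] := @vertex_exists i [::] isT; apply/card_gt0P; exists x.
Qed.

Lemma code_forest_height : height arc <= h.
Proof. by apply: graded_height arc_depth _ _ => x; apply: size_bseq. Qed.

Lemma code_forest_Ackermann : Ackermann_code (A := code_forest) code.
Proof.
move=> x j; split=> [xj|[y /arcP[xy [l yl]] <-]].
  have jh : j < Tower h := ltn_trans (testbit_ltn xj) (ltn_ord (code x)).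
  have xjP : path has_bit (number (tree x)) (rcons (trail x) (Ordinal jh)).
    by rewrite rcons_path trailP.
  have [y ytree ytrail] := vertex_exists xjP.
  exists y; last by rewrite /code ytrail last_rcons.
  by apply/arcP; split=> //; exists (Ordinal jh).
by have := trailP y; rewrite /code yl last_rcons rcons_path xy => /andP[].
Qed.

Lemma parentless_trail x : parentless (A := code_forest) x <-> trail x = [::].
Proof.
split=> [rx|xnil y /arcP[_ [l]]]; last by rewrite xnil; case: (trail y).
have := trailP x; move xE: (trail x) => q; case/lastP: q xE => // p l xE.
rewrite rcons_path => /andP[xp _].
have [y yt yp] := vertex_exists xp.
by case: (rx y); apply/arcP; rewrite yp; split=> //; exists l.
Qed.

Lemma twin_formula_code_forest :
  models code_forest (twin_formula h) <->
  forall i, exists2 j, i != j & number i = number j.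
Proof.
apply: iff_trans (models_twin_formula _ _) _; split=> [twins i|twins x].
  have [x xi xnil] := @vertex_exists i [::] isT.
  have [|y [xy /parentless_trail ynil xy_bisim]] := twins x.
    exact/parentless_trail.
  exists (tree y).
    apply: contra_not_neq xy => iy.
    by apply: vertex_eq; rewrite ?xi // xnil ynil.
  apply/val_inj; rewrite -xi.
  have := bisimilar_eq_code code_forest_Ackermann (ltn_ord _) (ltn_ord _).
  by move=> /(_ _ _ xy_bisim); rewrite /code xnil ynil.
move/parentless_trail => xnil; have [j xj eqn] := twins (tree x).
have [y yj ynil] := @vertex_exists j [::] isT.
exists y; split; first by move=> xy; rewrite xy yj eqxx in xj.
  exact/parentless_trail.
apply: (eq_code_bisimilar code_forest_Ackermann).
by rewrite /code xnil ynil yj eqn.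
Qed.

End Family.

Section Reindexing.
Variables (I J : finType) (f : J -> I) (number : I -> 'I_(Tower h)).
Hypothesis injf : injective f.

Definition reindex_vertex (x : vertex (number \o f)) : vertex number :=
  exist _ (f (tree x), (val x).2) (trailP x).

Lemma reindex_vertex_image x :
  tree x \in codom f -> in_image reindex_vertex x.
Proof.
case/codomP=> j xj; have xp := trailP x; rewrite xj in xp.
have [y yj yp] := @vertex_exists _ (number \o f) j _ xp.
by exists y; apply: vertex_eq; [rewrite xj -yj | rewrite -yp].
Qed.

Lemma reindex_vertex_component_embedding :
  component_embedding (reindex_vertex : code_forest _ -> code_forest _).
Proof.
split; first split=> [x y xy|x y].
- apply: vertex_eq; first by have [/injf] := congr1 val xy.
  by have [] := congr1 (@trail _ _) xy.
- by rewrite /= /arc /= (inj_eq injf).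
- move=> x b xb; apply: reindex_vertex_image.
  have -> : tree b = f (tree x) by case: xb => /arcP[].
  exact: codom_f.
Qed.

End Reindexing.

Lemma BSNF_code_forest_delete (I : finType) (number : I -> 'I_(Tower h)) psi :
    BSNF psi -> fsize psi <= 2 * #|I| -> models (code_forest number) psi ->
  exists i, models (code_forest (number \o (val : {j | j != i} -> I))) psi.
Proof.
move=> nf small sat_psi.
have /card_gt0P[i0 _] : 0 < #|I| by have := fsize_gt0 psi; lia.
have [x0 _ _] := @vertex_exists _ number i0 [::] isT.
have [n [w [n_lt delete]]] := @BSNF_witnesses
  (code_forest number) _ nf (inhabits x0) sat_psi.
have [i i_avoids] : exists i, i \notin codom (fun k => tree (w k)).
  by apply: exists_notin_codom; rewrite card_ord; lia.
exists i.
apply: (delete _ _ (reindex_vertex_component_embedding number val_inj)) => k.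
apply: reindex_vertex_image; apply/codomP.
have ki : tree (w k) != i by apply: contraNneq i_avoids => <-; apply: codom_f.
by exists (exist _ (tree (w k)) ki).
Qed.

Lemma equiv_twin_formula_code_forest (I : finType) (number : I -> 'I_(Tower h))
    psi :
    equiv_on_forests h (twin_formula h) psi -> 0 < #|I| ->
  models (code_forest number) psi <->
  forall i, exists2 j, i != j & number i = number j.
Proof.
move=> equiv I_gt0; apply: iff_trans (twin_formula_code_forest _).
apply: iff_sym.
exact: equiv (code_forest_is_forest _ I_gt0) (code_forest_height _).
Qed.

Lemma BSNF_twin_formula_fsize psi :
    BSNF psi -> equiv_on_forests h (twin_formula h) psi ->
  4 * Tower h < fsize psi.
Proof.
move=> nf equiv; rewrite ltnNge; apply/negP => small.
pose I : finType := (bool * 'I_(Tower h))%type.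
pose twin (i : I) : I := (~~ i.1, i.2).
have twin_neq i : twin i != i by case: i => [[] n].
have only_twin i j : i.2 = j.2 -> j != i -> j = twin i.
  by case: i j => [[] n] [[] m] //= ->; rewrite ?eqxx.
have cardI : #|I| = 2 * Tower h by rewrite card_prod card_bool card_ord.
have [i] :
    exists i, models (code_forest (snd \o (val : {j | j != i} -> I))) psi.
  apply: BSNF_code_forest_delete nf _ _; first by rewrite cardI; lia.
  apply/(equiv_twin_formula_code_forest _ equiv) => [|i].
    by rewrite cardI; have := Tower_gt0 h; lia.
  by exists (twin i); rewrite // eq_sym.
pose i' : {j | j != i} := exist _ (twin i) (twin_neq i).
have rest_gt0 : 0 < #|{: {j | j != i}}| by apply/card_gt0P; exists i'.
have equiv_rest := equiv_twin_formula_code_forest _ equiv rest_gt0.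
move=> /equiv_rest/(_ i')[[j ji]].
rewrite -val_eqE /= => i'j /only_twin/(_ ji) jE.
by rewrite jE eqxx in i'j.
Qed.

End CodeForest.

Theorem theorem9 :
  exists phi : nat -> formula,
    [/\ forall h : nat, 1 <= h -> sentence (phi h),
        exists C : nat, forall h : nat, 1 <= h -> fsize (phi h) <= C * h
      & forall h : nat, 1 <= h ->
          forall psi : formula, BSNF psi -> equiv_on_forests h (phi h) psi ->
            Tower h < fsize psi].
Proof.
exists twin_formula; split=> [h _||h _ psi nf equiv].
- exact: sentence_twin_formula.
- by exists 96 => h h_gt0; rewrite fsize_twin_formula; lia.
- by have := BSNF_twin_formula_fsize nf equiv; lia.
Qed.
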